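(* Let $k\ge 2$ and $n\ge\max\{2k,k+4\}$ be integers. If a graph $G$ of order $2n-1$ contains a Hamilton-connected subgraph of order $n-1$, then $G$ contains $C_n$ or its complement $\overline{G}$ contains $K_1+C_{2k}$.
   Context: All graphs are finite and simple; ''contains'' means contains as a (not necessarily induced) subgraph. The order of a graph is its number of vertices. $C_m$ is the cycle on $m$ vertices, and $K_1+C_{2k}$ is the wheel on $2k+1$ vertices (a cycle $C_{2k}$ together with one additional vertex adjacent to all vertices of the cycle). A graph is Hamilton-connected if every two distinct vertices are the endpoints of a spanning path. *)

(* Defs.v *)
From mathcomp Require Import all_boot.

Set Implicit Arguments.
Unset Strict Implicit.
Unset Printing Implicit Defensive.

Record sgraph := SGraph {
  vertex :> finType;
  adj : rel vertex;
  adj_sym : symmetric adj;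
  adj_irrefl : irreflexive adj
}.

(* [G] has a not necessarily induced subgraph isomorphic to [H]. *)
Definition contains (G H : sgraph) : Prop :=
  exists f : H -> G,
    injective f /\ (forall x y : H, adj x y -> adj (f x) (f y)).

Definition hamilton_connected (G : sgraph) : Prop :=
  forall x y : G, x != y ->
    exists p : seq G,
      [/\ path (@adj G) x p, last x p = y, uniq (x :: p)
        & forall z : G, z \in x :: p].

Section Complement.
Variable G : sgraph.
Definition compl_adj : rel G := [rel x y | (x != y) && ~~ adj x y].
Lemma compl_adj_sym : symmetric compl_adj.
Proof. by move=> x y; rewrite /compl_adj /= eq_sym adj_sym. Qed.
Lemma compl_adj_irrefl : irreflexive compl_adj.
Proof. by move=> x; rewrite /compl_adj /= eqxx. Qed.
Definition complement : sgraph := SGraph compl_adj_sym compl_adj_irrefl.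
End Complement.

Section Complete.
Variable m : nat.
Definition complete_adj : rel 'I_m := [rel i j | i != j].
Lemma complete_adj_sym : symmetric complete_adj.
Proof. by move=> i j; rewrite /complete_adj /= eq_sym. Qed.
Lemma complete_adj_irrefl : irreflexive complete_adj.
Proof. by move=> i; rewrite /complete_adj /= eqxx. Qed.
Definition complete_graph : sgraph := SGraph complete_adj_sym complete_adj_irrefl.
End Complete.

(* [ordS] is the successor modulo [m]; this is the cycle C_m for [m >= 3]. *)
Section Cycle.
Variable m : nat.
Definition cycle_adj : rel 'I_m :=
  [rel i j | (i != j) && ((j == ordS i) || (i == ordS j))].
Lemma cycle_adj_sym : symmetric cycle_adj.
Proof. by move=> i j; rewrite /cycle_adj /= eq_sym orbC. Qed.
Lemma cycle_adj_irrefl : irreflexive cycle_adj.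
Proof. by move=> i; rewrite /cycle_adj /= eqxx. Qed.
Definition cycle_graph : sgraph := SGraph cycle_adj_sym cycle_adj_irrefl.
End Cycle.

(* The join G + H: the disjoint union together with all edges between the two
   parts. *)
Section Join.
Variables G H : sgraph.
Definition join_adj : rel (G + H)%type := fun u v =>
  match u, v with
  | inl x, inl y => adj x y
  | inr x, inr y => adj x y
  | _, _ => true
  end.
Lemma join_adj_sym : symmetric join_adj.
Proof. by move=> [x|x] [y|y] //=; rewrite adj_sym. Qed.
Lemma join_adj_irrefl : irreflexive join_adj.
Proof. by move=> [x|x] /=; rewrite adj_irrefl. Qed.
Definition join : sgraph := SGraph join_adj_sym join_adj_irrefl.
End Join.

(* Main.v *)
Require Import Defs.
From mathcomp Require Import all_boot.
From mathcomp Require Import zify.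

(** Let [A] be the vertex set of the Hamilton-connected subgraph, so that
    [#|A| = n - 1], and let [U] be its complement, so that [#|U| = n].

    If some [u] in [U] has two neighbours in [A], a spanning path of [A]
    between them closes up through [u] into a [C_n]
    ([hamilton_connected_extend]). Otherwise the complement of [G] contains
    almost all edges between [U] and [A]: each vertex of [U] misses at most one
    vertex of [A]. Two cases remain, depending on the non-neighbours inside [U].

    - Some [c] in [U] has [k] non-neighbours in [U]. It is the hub of a wheel in
      the complement: these [k] vertices are interleaved greedily with [k]
      vertices of [A] not adjacent to [c] ([alternating_cycle]). At least
      [n - 2 >= k + 2] vertices of [A] are available, which is what the greedy
      choice needs, since each new vertex has to avoid at most [k - 1] used ones
      and the single forbidden vertex of each of its two neighbours.
    - Every vertex of [U] has at most [k - 1] non-neighbours in [U], hence at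
      least [n - k >= n / 2] neighbours there, and Dirac's theorem ([dirac])
      gives a Hamilton cycle of [U], which is a [C_n].

    Dirac's theorem is proved by improving an arbitrary cyclic ordering of the
    vertices: as long as two consecutive vertices are not adjacent, reversing
    a suitable segment decreases the number of such pairs. *)

(** * Dirac's theorem *)

Section Dirac.
Variables (T : eqType) (e : rel T).
Hypotheses (e_sym : symmetric e) (e_irr : irreflexive e).

Definition gaps (x : T) (p : seq T) : nat :=
  count id (pairmap (fun u v => ~~ e u v) x p).

Lemma gaps_cat x p q : gaps x (p ++ q) = gaps x p + gaps (last x p) q.
Proof. by rewrite /gaps pairmap_cat count_cat. Qed.

Lemma gaps_rev x p : gaps (last x p) (rev (belast x p)) = gaps x p.
Proof.
elim: p x => [|y p IHp] x //=.
rewrite rev_cons -cats1 gaps_cat IHp.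
have -> : last (last y p) (rev (belast y p)) = y.
  by case: p {IHp} => //= z p; rewrite rev_cons last_rcons.
by rewrite /gaps /= addn0 addnC e_sym.
Qed.

Lemma gaps_eq0 x p : (gaps x p == 0) = path e x p.
Proof.
elim: p x => //= y p IHp x.
by rewrite -IHp /gaps /= addn_eq0 eqb0 negbK.
Qed.

Lemma gap_split x p :
  ~~ path e x p -> exists p1 y p2, p = p1 ++ y :: p2 /\ ~~ e (last x p1) y.
Proof.
elim: p x => //= y p IHp x; case: (boolP (e x y)) => [_|xy _] /=.
  by case/IHp=> p1 [z [p2 [-> ?]]]; exists (y :: p1), z, p2.
by exists [::], y, p.
Qed.

(** Among the [size p] consecutive pairs of [x :: p], one has its second entry
    in [a] and its first in [b]: the two counts exceed the number of pairs. *)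
Lemma consecutive_pigeonhole (a b : pred T) x p :
  size p < count a p + count b (belast x p) ->
  exists p1 y p2, [/\ p = p1 ++ y :: p2, a y & b (last x p1)].
Proof.
elim: p x => //= y p IHp x.
case: (boolP (a y && b x)) => [/andP[ay bx] _|nab lt_p]; first by exists [::], y, p.
have /IHp[p1 [z [p2 [-> az bl]]]] : size p < count a p + count b (belast y p).
  by move: nab lt_p; case: (a y) (b x) => [] []; lia.
by exists (y :: p1), z, p2.
Qed.

(** Replacing [x ... w y ... z], where [z] is the last entry, by
    [w ... x y ... z] trades the pair [w y] for [x y] and the closing pair [z x]
    for [z w]. By the degree condition and the pigeonhole principle, some
    consecutive [w], [y] make both new pairs edges. *)
Lemma close_arrangement x p :
    {in x :: p, forall y, size (x :: p) <= 2 * count (e y) (x :: p)} ->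
  exists y q, [/\ perm_eq (y :: q) (x :: p), e (last y q) y
                & gaps y q <= gaps x p].
Proof.
move=> deg.
(* As [e] is irreflexive, the neighbours of [x] all lie in [p], and those of the
   last entry all lie in [belast x p]; both have the size of [p]. *)
have degx := deg x (mem_head x p); have degz := deg _ (mem_last x p).
rewrite [in count _ _]lastI -cats1 count_cat /= e_irr in degz.
rewrite /= e_irr in degx.
have [|p1 [y [p2 [def_p xy wz]]]] :=
    @consecutive_pigeonhole (e x) (e (last x p)) x p; first by lia.
have def_rev : last x p1 :: rev (belast x p1) = rev (x :: p1).
  by rewrite [in RHS]lastI rev_rcons.
exists (last x p1), (rev (belast x p1) ++ y :: p2); split.
- by rewrite -cat_cons def_rev def_p -cat_cons perm_cat2r perm_rev.
- by rewrite last_cat /=; move: wz; rewrite def_p last_cat.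
have last_x : last (last x p1) (rev (belast x p1)) = x.
  by case: (p1) => //= t p'; rewrite rev_cons last_rcons.
rewrite def_p !gaps_cat gaps_rev last_x leq_add2l.
by rewrite /gaps /= xy leq_addl.
Qed.

(** By induction on the number of gaps: once the closing pair is an edge, a
    rotation that moves a gap to the closing position removes it from the linear
    count. Working with lists up to [perm_eq] covers any induced subgraph
    without forming a subtype. *)
Theorem dirac s :
    {in s, forall y, size s <= 2 * count (e y) s} ->
  exists2 s', perm_eq s' s & cycle e s'.
Proof.
case: s => [|x p]; first by exists [::].
have [m] := ubnP (gaps x p); elim: m => // m IHm in x p * => lt_m deg.
have [y [q [perm_yq closed le_gaps]]] := close_arrangement _ _ deg.
case: (boolP (path e y q)) => [path_q|/(gap_split _ _)[p1 [z [p2 [def_q gap]]]]].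
  by exists (y :: q); rewrite //= rcons_path path_q.
have perm_rot : perm_eq (z :: p2 ++ y :: p1) (x :: p).
  by rewrite -(permPr perm_yq) def_q -cat_cons perm_catC.
have [||s' perm_s' cyc_s'] := IHm z (p2 ++ y :: p1).
- suff -> : (gaps z (p2 ++ y :: p1) < m) = (gaps y q < m.+1).
    exact: leq_ltn_trans lt_m.
  move: closed; rewrite def_q last_cat /= => closed.
  by rewrite !gaps_cat /gaps /= closed gap /= add0n add1n addnS addnC.
- move=> t; rewrite (perm_mem perm_rot) (perm_size perm_rot).
  by move=> t_in; rewrite (permP perm_rot); apply: deg.
by exists s' => //; apply: perm_trans perm_rot.
Qed.

End Dirac.

(** * Alternating cycles in almost complete bipartite graphs *)

Section Alternating.
Variables (T : finType) (r : rel T).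
Hypothesis r_sym : symmetric r.

Lemma common_neighbour (B : {set T}) u v :
    #|[set h in B | ~~ r u h]| <= 1 -> #|[set h in B | ~~ r v h]| <= 1 ->
  2 < #|B| -> exists2 h, h \in B & r u h && r v h.
Proof.
move=> Bu Bv cardB; apply/exists_inP; apply: contraLR cardB => none.
rewrite -leqNgt -[2]/(1 + 1); apply: leq_trans (leq_add Bu Bv).
apply: leq_trans (leq_card_setU _ _); apply/subset_leq_card/subsetP => h hB.
rewrite !inE hB /= -negb_and.
by apply: contra none => ?; apply/exists_inP; exists h.
Qed.

(** Greedy choice along [us]: each step picks a common neighbour in [B] of two
    successive vertices, removes it from [B], and needs [B] to have at least
    three elements left. The vertex [z] is the one to which the last chosen
    vertex has to return, so that the path can be closed. *)
Lemma alternating_path (z u : T) (us : seq T) (B : {set T}) :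
    {in [:: z, u & us], forall v, #|[set h in B | ~~ r v h]| <= 1} ->
    {in us, forall v, v \notin B} -> uniq us -> size us + 2 < #|B| ->
  exists q, [/\ path r u q, r (last u q) z, uniq q,
                {subset q <= [predU us & B]} & size q = (size us).*2.+1].
Proof.
elim: us u B => [|v us IHus] u B almost disj uniq_us cardB.
  have [|||h hB /andP[uh zh]] := @common_neighbour B u z => //.
  - by apply: almost; rewrite !inE eqxx orbT.
  - by apply: almost; rewrite !inE eqxx.
  exists [:: h]; rewrite /= uh r_sym zh; split=> // t.
  by rewrite !inE => /eqP->; rewrite hB.
have [|||h hB /andP[uh vh]] := @common_neighbour B u v.
- by apply: almost; rewrite !inE eqxx orbT.
- by apply: almost; rewrite !inE eqxx !orbT.
- by move: cardB => /=; lia.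
case/andP: uniq_us => v_us uniq_us.
have vB : v \notin B by apply: disj; apply: mem_head.
have [||||q [path_q last_q uniq_q sub_q size_q]] := IHus v (B :\ h) => //.
- move=> t t_in; apply: leq_trans (almost t _); last first.
    by move: t_in; rewrite !inE => /or3P[]->; rewrite ?orbT.
  by apply/subset_leq_card/subsetP => g; rewrite !inE -andbA => /and3P[_ -> ->].
- by move=> t t_us; rewrite !inE negb_and disj ?orbT // inE t_us orbT.
- by move: cardB => /=; rewrite (cardsD1 h B) hB; lia.
have h_us : h \notin us.
  by apply/negP => h_us; move: (disj h); rewrite hB inE h_us orbT => /(_ isT).
exists [:: h, v & q]; split => //=; last by rewrite size_q.
- by rewrite uh r_sym vh.
- rewrite uniq_q andbT inE negb_or -andbA; apply/and3P; split.
  + by apply: contraNneq vB => <-.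
  + by apply/negP => /sub_q; rewrite !inE (negbTE h_us) eqxx.
  by apply/negP => /sub_q; rewrite !inE (negbTE v_us) (negbTE vB) andbF.
move=> t; rewrite !inE => /or3P[/eqP->|/eqP->|/sub_q]; rewrite ?eqxx ?hB ?orbT //.
by rewrite !inE => /orP[->|/andP[_ ->]]; rewrite ?orbT.
Qed.

Lemma alternating_cycle (us : seq T) (B : {set T}) :
    0 < size us -> uniq us -> {in us, forall v, v \notin B} ->
    {in us, forall v, #|[set h in B | ~~ r v h]| <= 1} ->
    size us + 2 <= #|B| ->
  exists s, [/\ cycle r s, uniq s, {subset s <= [predU us & B]}
              & size s = (size us).*2].
Proof.
case: us => // u us _ /andP[u_us uniq_us] disj almost cardB.
have [||||q [path_q last_q uniq_q sub_q size_q]] :=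
    @alternating_path u u us B => //.
- by move=> v; rewrite !inE orbA orbb => ?; apply: almost; rewrite inE.
- by move=> v v_us; apply: disj; rewrite inE v_us orbT.
exists (u :: q); split=> /=.
- by rewrite rcons_path path_q.
- rewrite uniq_q andbT; apply/negP => /sub_q.
  by rewrite !inE (negbTE u_us) (negbTE (disj u (mem_head _ _))).
- move=> t; rewrite !inE => /orP[/eqP->|/sub_q]; first by rewrite eqxx.
  by rewrite !inE => /orP[]->; rewrite ?orbT.
by rewrite size_q.
Qed.

End Alternating.

(** * Embedding cycles and wheels *)

Lemma nth_cycle (T : eqType) (e : rel T) x0 (s : seq T) i :
  cycle e s -> i < size s -> e (nth x0 s i) (nth x0 s (i.+1 %% size s)).
Proof.
case: s => // x p /(pathP x0) /=; rewrite size_rcons => path_p lt_i.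
have := path_p i lt_i; rewrite nth_rcons -rcons_cons nth_rcons /= lt_i.
move: lt_i; rewrite ltnS leq_eqVlt => /orP[/eqP->|lt_i].
  by rewrite ltnn eqxx modnn.
by rewrite lt_i modn_small.
Qed.

Lemma cycle_embedding {G : sgraph} (s : seq G) :
    uniq s -> cycle (@adj G) s ->
  exists f : cycle_graph (size s) -> G,
    [/\ injective f, forall i j, adj i j -> adj (f i) (f j)
      & forall i, f i \in s].
Proof.
move=> uniq_s cyc_s; case: s => [|x p] in uniq_s cyc_s *.
  by exists (fun i : 'I_0 => match notF (ltn_ord i) with end); split; case.
have succ (i : 'I_(size (x :: p))) :
    adj (nth x (x :: p) i) (nth x (x :: p) (ordS i)) by apply: nth_cycle.
exists (fun i : 'I_(size (x :: p)) => nth x (x :: p) i); split.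
- by move=> i j /eqP; rewrite nth_uniq ?ltn_ord // => /eqP/val_inj.
- by move=> i j /andP[_ /orP[/eqP->|/eqP->]]; rewrite // adj_sym.
by move=> i; rewrite mem_nth.
Qed.

Lemma contains_cycle (G : sgraph) (s : seq G) m :
  uniq s -> cycle (@adj G) s -> size s = m -> contains G (cycle_graph m).
Proof.
by move=> uniq_s cyc_s <-; have [f [? ? _]] := cycle_embedding _ uniq_s cyc_s; exists f.
Qed.

Lemma contains_wheel (G : sgraph) (c : G) (s : seq G) m :
    uniq s -> cycle (@adj G) s -> {in s, forall v, adj c v} -> size s = m ->
  contains G (join (complete_graph 1) (cycle_graph m)).
Proof.
move=> uniq_s cyc_s hub <-.
have [f [f_inj f_hom f_s]] := cycle_embedding _ uniq_s cyc_s.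
have cf i : adj c (f i) by apply: hub.
exists (fun v : join (complete_graph 1) _ =>
          match v with inl _ => c | inr i => f i end).
split.
- move=> [i|i] [j|j] //=; first by rewrite !ord1.
  + by move=> eq_c; move: (cf j); rewrite -eq_c adj_irrefl.
  + by move=> eq_c; move: (cf i); rewrite eq_c adj_irrefl.
  by move/f_inj->.
case=> [i|i] [j|j] //.
- by rewrite !ord1 adj_irrefl.
- by move=> _; rewrite adj_sym.
exact: f_hom.
Qed.

(** * Cycles and wheels around a Hamilton-connected subgraph *)

Lemma hamilton_connected_extend (G H : sgraph) (f : H -> G) (u : G) :
    hamilton_connected H -> injective f ->
    (forall x y, adj x y -> adj (f x) (f y)) -> u \notin codom f ->
    1 < #|[set h in codom f | adj u h]| ->
  contains G (cycle_graph #|H|.+1).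
Proof.
move=> ham f_inj f_hom u_f /card_gt1P[h1 [h2 []]].
rewrite !inE => /andP[/codomP[a ->] ua] /andP[/codomP[b ->] ub].
rewrite (inj_eq f_inj) => /ham[p [path_p last_p uniq_p full_p]].
apply: (@contains_cycle G (u :: map f (a :: p))).
- rewrite cons_uniq map_inj_uniq // uniq_p andbT.
  by apply: contra u_f => /mapP[y _ ->]; apply: codom_f.
- rewrite /= ua rcons_path last_map last_p adj_sym ub andbT path_map.
  exact: sub_path path_p.
rewrite /= size_map -[(size p).+1]/(size (a :: p)) -(card_uniqP uniq_p).
by congr _.+1; apply: eq_card => y; rewrite full_p.
Qed.

Theorem lemma2p2 (k n : nat) (hk : 2 <= k) (hn : maxn (2 * k) (k + 4) <= n)
    (G : sgraph) (hG : #|G| = 2 * n - 1)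
    (hH : exists H : sgraph,
        [/\ #|H| = n - 1, hamilton_connected H & contains G H]) :
  contains G (cycle_graph n) \/
  contains (complement G) (join (complete_graph 1) (cycle_graph (2 * k))).
Proof.
case: hH => H [cardH ham [f [f_inj f_hom]]].
pose A := [set x in codom f]; pose U := ~: A.
have cardA : #|A| = n - 1 by rewrite cardsE card_codom.
have cardU : #|U| = n by have := cardsC A; rewrite cardA hG -/U; lia.
case: (boolP [exists u in U, 1 < #|[set h in codom f | adj u h]|]).
  case/exists_inP=> u; rewrite !inE => u_f gt1; left.
  have -> : n = #|H|.+1 by lia.
  exact: hamilton_connected_extend gt1.
move/exists_inPn => few.
case: (boolP [exists c in U, k <= #|[set v in U | @compl_adj G c v]|]); last first.
  move/exists_inPn => dense; left.
  have [|s perm_s cyc_s] := @dirac G (@adj G) (@adj_sym G) (@adj_irrefl G) (enum U).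
  - move=> u; rewrite mem_enum -cardE cardU => uU.
    have := dense u uU; rewrite -ltnNge.
    have <- : #|[set v in U | adj u v]| = count (adj u) (enum U).
      rewrite -size_filter cardE /enum_mem -filter_predI; congr size.
      by apply: eq_filter => v; rewrite !inE andbC.
    have : #|U| <= 1 + #|[set v in U | adj u v]|
                   + #|[set v in U | @compl_adj G u v]|.
      rewrite -(cards1 u); apply: leq_trans (leq_add (leq_card_setU _ _) (leqnn _)).
      apply: leq_trans (leq_card_setU _ _).
      apply/subset_leq_card/subsetP => v vU; rewrite !inE in vU *.
      by rewrite vU /compl_adj /= (eq_sym u v); case: eqP => //= _; case: (adj u v).
    rewrite cardU; lia.
  apply: (@contains_cycle G s) => //.
    by rewrite (perm_uniq perm_s) enum_uniq.
  by rewrite (perm_size perm_s) -cardE.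
case/exists_inP=> c cU many; right.
pose us := take k (enum [set v in U | @compl_adj G c v]).
have size_us : size us = k by rewrite size_takel // -cardE.
have us_sub v : v \in us -> v \in U /\ @compl_adj G c v.
  by move/mem_take; rewrite mem_enum inE => /andP.
pose B := [set h in A | @compl_adj G c h].
have compl_few u : u \in U -> #|[set h in A | ~~ @compl_adj G u h]| <= 1.
  move=> uU; apply: leq_trans (_ : #|[set h in codom f | adj u h]| <= 1); last first.
    by rewrite leqNgt few.
  apply/subset_leq_card/subsetP => h; rewrite !inE negb_and !negbK.
  case/andP=> h_f /orP[/eqP eq_uh|->]; last by rewrite h_f.
  by move: uU; rewrite !inE eq_uh h_f.
have [|||||s [cyc_s uniq_s sub_s size_s]] :=
    @alternating_cycle G (@compl_adj G) (@compl_adj_sym G) us B.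
- by rewrite size_us; lia.
- by rewrite take_uniq ?enum_uniq.
- by move=> v /us_sub[]; rewrite !inE => /negbTE->.
- move=> v /us_sub[vU _]; apply: leq_trans (compl_few v vU).
  by apply/subset_leq_card/subsetP => h; rewrite !inE -andbA => /and3P[-> _ ->].
- have := cardsID [set h | @compl_adj G c h] A.
  have -> : A :&: [set h | @compl_adj G c h] = B by apply/setP => h; rewrite !inE.
  have := compl_few c cU.
  have -> : [set h in A | ~~ @compl_adj G c h] = A :\: [set h | @compl_adj G c h].
    by apply/setP => h; rewrite !inE andbC.
  rewrite size_us cardA; lia.
apply: (@contains_wheel (complement G) c s) => //.
  move=> v /sub_s; rewrite !inE => /orP[/us_sub[_ ]|/andP[_]] //.
by rewrite size_s size_us mul2n.
Qed.
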